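(* Let $\sigma$ be a trace and let $e\in\mathsf{Events}(\sigma)$ be a read or write event. The SHB vector clock algorithm, run on $\sigma$, reports a race at $e$ if and only if there is an event $e'\in\mathsf{Events}(\sigma)$ such that $(e',e)$ is a $\leq^\sigma_{\mathsf{HB}}$-schedulable race.
   Context: **Traces.** A trace $\sigma$ is a sequence of events of the form $e=\langle t, op\rangle$, where $t$ is a thread (the thread performing $e$) and $op$ is one of $\mathtt{r}(x)$, $\mathtt{w}(x)$ (read/write of memory location $x$), $\mathtt{acq}(\ell)$, $\mathtt{rel}(\ell)$ (acquire/release of lock $\ell$), $\mathtt{fork}(u)$, $\mathtt{join}(u)$ (fork/join of thread $u$). Each event has a unique identifier. Locks are not reentrant. $\mathsf{Threads}(\sigma)$ and $\mathsf{Events}(\sigma)$ are the sets of threads and events of $\sigma$. Traces are well formed: for every lock $\ell$, the subsequence of acquire and release events of $\ell$ is a prefix of a string in the regular language $\big(\bigcup_{t}\langle t,\mathtt{acq}(\ell)\rangle\cdot\langle t,\mathtt{rel}(\ell)\rangle\big)^*$. **Events of a thread; last write.** $e=\langle t_1,op\rangle$ is an event of thread $t$ if $t=t_1$ or $op\in\{\mathtt{fork}(t),\mathtt{join}(t)\}$. $\sigma|_t$ is the maximal subsequence of $\sigma$ consisting of events of thread $t$. For a read event $e$ of $x$, $\mathsf{lastWr}_\sigma(e)$ is the last $\mathtt{w}(x)$-event before $e$ in $\sigma$ (possibly undefined). **Orders on $\mathsf{Events}(\sigma)$.** $e\leq^\sigma_{\mathsf{tr}}e'$ iff $e=e'$ or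 $e$ appears before $e'$ in $\sigma$. $\leq^\sigma_{\mathsf{TO}}$ is the smallest partial order with $e\leq^\sigma_{\mathsf{TO}}e'$ whenever $e\leq^\sigma_{\mathsf{tr}}e'$ and $e,e'$ are events of the same thread. $\leq^\sigma_{\mathsf{HB}}$ is the smallest partial order containing $\leq^\sigma_{\mathsf{TO}}$ such that $e\leq^\sigma_{\mathsf{HB}}e'$ whenever $e=\langle t,\mathtt{rel}(\ell)\rangle$, $e'=\langle t',\mathtt{acq}(\ell)\rangle$ and $e\leq^\sigma_{\mathsf{tr}}e'$. **Reorderings.** A trace $\sigma'$ is a correct reordering of $\sigma$ if (a) for every $t\in\mathsf{Threads}(\sigma')$, $\sigma'|_t$ is a prefix of $\sigma|_t$; and (b) for every read event $e=\langle t,\mathtt{r}(x)\rangle$ of $\sigma'$ that is not the last event of $\sigma'|_t$, $\mathsf{lastWr}_{\sigma'}(e)$ exists iff $\mathsf{lastWr}_\sigma(e)$ exists, and if they exist they are equal. $\sigma'$ respects $\leq^\sigma_{\mathsf{HB}}$ if for all $e,e'\in\mathsf{Events}(\sigma)$ with $e\leq^\sigma_{\mathsf{HB}}e'$ and $e'\in\mathsf{Events}(\sigma')$, we have $e\in\mathsf{Events}(\sigma')$ and $e\leq^{\sigma'}_{\mathsf{tr}}e'$. **Races.** Two read/write events are conflicting if they access the same location, are performed by different threads, and at least one is a write. For conflicting $e\leq^\sigma_{\mathsf{tr}}e'$, $(e,e')$ is a $\leq^\sigma_{\mathsf{HB}}$-schedulable race if there is a correct reordering $\sigma'$ of $\sigma$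 that respects $\leq^\sigma_{\mathsf{HB}}$ and has the form $\sigma'=\sigma''ee'$ or $\sigma'=\sigma''e'e$ for some trace $\sigma''$. (So the first component of the pair always comes earlier in $\sigma$.) **Vector times.** A vector time is a map $V:\mathsf{Threads}(\sigma)\to\mathbb{N}$. $V_1\sqsubseteq V_2$ iff $V_1(t)\le V_2(t)$ for all $t$; $V_1\sqcup V_2$ is the pointwise maximum; $V[n/u]$ agrees with $V$ except that it maps $u$ to $n$; $\bot$ is constantly $0$. **The SHB vector clock algorithm.** State: vector-time-valued variables $\mathbb{C}_t$ (each thread $t$), $\mathbb{L}_\ell$ (each lock $\ell$), $\mathbb{LW}_x,\mathbb{R}_x,\mathbb{W}_x$ (each location $x$). Initially $\mathbb{C}_t=\bot[1/t]$ and all others are $\bot$. Events are processed in trace order: - $\langle t,\mathtt{acq}(\ell)\rangle$: $\mathbb{C}_t:=\mathbb{C}_t\sqcup\mathbb{L}_\ell$. - $\langle t,\mathtt{rel}(\ell)\rangle$: $\mathbb{L}_\ell:=\mathbb{C}_t$; then $\mathbb{C}_t(t):=\mathbb{C}_t(t)+1$. - $\langle t,\mathtt{fork}(u)\rangle$: $\mathbb{C}_u:=\mathbb{C}_t[1/u]$; then $\mathbb{C}_t(t):=\mathbb{C}_t(t)+1$. - $\langle t,\mathtt{join}(u)\rangle$: $\mathbb{C}_t:=\mathbb{C}_t\sqcup\mathbb{C}_u$. - $\langle t,\mathtt{r}(x)\rangle$: if $\neg(\mathbb{W}_x\sqsubseteq\mathbb{C}_t)$ declare a race; then $\mathbb{C}_t:=\mathbb{C}_t\sqcup\mathbb{LW}_x$;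 $\mathbb{R}_x(t):=\mathbb{C}_t(t)$. - $\langle t,\mathtt{w}(x)\rangle$: if $\neg(\mathbb{R}_x\sqsubseteq\mathbb{C}_t)$ declare a race; if $\neg(\mathbb{W}_x\sqsubseteq\mathbb{C}_t)$ declare a race; then $\mathbb{LW}_x:=\mathbb{C}_t$; $\mathbb{W}_x(t):=\mathbb{C}_t(t)$; $\mathbb{C}_t(t):=\mathbb{C}_t(t)+1$. The algorithm reports a race at $e$ if it declares a race while processing $e$.
   Formalization: The trace σ is additionally assumed to have well-formed forks and joins: every fork(u) is the first and every join(u) the last event of σ|_u; without this the claim fails, e.g. on ⟨t,w(x)⟩⟨t,join(u)⟩⟨u,w(x)⟩. *)

(* Defs.v *)
From HB Require Import structures.
From mathcomp Require Import all_boot.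

Set Implicit Arguments.
Unset Strict Implicit.
Unset Printing Implicit Defensive.

(* [T], [X], [L] are the types of thread, memory location
   and lock names. *)

Inductive op (T X L : Type) : Type :=
| Read of X
| Write of X
| Acq of L
| Rel of L
| Fork of T
| Join of T.

Arguments Read {T X L} x.
Arguments Write {T X L} x.
Arguments Acq {T X L} l.
Arguments Rel {T X L} l.
Arguments Fork {T X L} u.
Arguments Join {T X L} u.

Section OpEqType.
Variables T X L : eqType.

Definition op_encode (o : op T X L) : (X + X) + (L + L) + (T + T) :=
  match o with
  | Read x => inl (inl (inl x))
  | Write x => inl (inl (inr x))
  | Acq l => inl (inr (inl l))
  | Rel l => inl (inr (inr l))
  | Fork u => inr (inl u)
  | Join u => inr (inr u)
  end.

Definition op_decode (c : (X + X) + (L + L) + (T + T)) : op T X L :=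
  match c with
  | inl (inl (inl x)) => Read x
  | inl (inl (inr x)) => Write x
  | inl (inr (inl l)) => Acq l
  | inl (inr (inr l)) => Rel l
  | inr (inl u) => Fork u
  | inr (inr u) => Join u
  end.

Lemma op_encodeK : cancel op_encode op_decode.
Proof. by case. Qed.

HB.instance Definition _ := Equality.copy (op T X L) (can_type op_encodeK).
End OpEqType.

Record event (T X L : Type) : Type :=
  Event { eid : nat; thr : T; opr : op T X L }.

Section EventEqType.
Variables T X L : eqType.

Definition event_encode (e : event T X L) : nat * T * op T X L :=
  (eid e, thr e, opr e).

Definition event_decode (p : nat * T * op T X L) : event T X L :=
  Event p.1.1 p.1.2 p.2.

Lemma event_encodeK : cancel event_encode event_decode.
Proof. by case. Qed.

HB.instance Definition _ := Equality.copy (event T X L) (can_type event_encodeK).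
End EventEqType.

Section Traces.
Variables T X L : eqType.
Implicit Types (s : seq (event T X L)) (e : event T X L) (t u : T).

Definition is_lock_op (l : L) (o : op T X L) : bool :=
  (o == Acq l) || (o == Rel l).

(* [flatten [seq ... | t <- ts]], for [ts] arbitrary, ranges over the strings of
   the regular language (U_t <t,acq(l)> <t,rel(l)>)^*. *)
Definition lock_wf s : Prop :=
  forall l : L, exists ts : seq T,
    prefix [seq (thr e, opr e) | e <- s & is_lock_op l (opr e)]
           (flatten [seq [:: (t, Acq l); (t, Rel l)] | t <- ts]).

Definition is_trace s : Prop := uniq (map (@eid T X L) s) /\ lock_wf s.

(* [e] is an event of thread [t] iff [t \in event_threads e]. *)
Definition event_threads e : seq T :=
  match opr e with
  | Fork u | Join u => [:: thr e; u]
  | _ => [:: thr e]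
  end.

Definition threads s : seq T := flatten (map event_threads s).

Definition proj s t : seq (event T X L) := [seq e <- s | t \in event_threads e].

(* The usual meaning of fork and join: [fork(u)] is the first event of thread
   [u] and [join(u)] is the last one.  The algorithm presupposes this: fork
   overwrites C_u and join does not propagate C_t into C_u.  For instance, on
   <t,w(x)> <t,join(u)> <u,w(x)> it reports a race at the last event, although
   the two writes are separated by <t,join(u)> in thread order (which counts as
   an event of both threads). *)
Definition fork_join_wf s : Prop :=
  forall e u, e \in s ->
    (opr e = Fork u -> head e (proj s u) = e) /\
    (opr e = Join u -> last e (proj s u) = e).

Definition lastWr s e : option (event T X L) :=
  if opr e is Read x
  then last None [seq Some f | f <- take (index e s) s & opr f == Write x]
  else None.

Definition tr_le s e e' : Prop :=
  [/\ e \in s, e' \in s & index e s <= index e' s].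

(* The smallest preorder on the events of [s] containing [R].  It is only used
   for [R] included in [tr_le s], so it is antisymmetric and hence the smallest
   partial order containing [R]. *)
Inductive order_closure s (R : event T X L -> event T X L -> Prop) :
  event T X L -> event T X L -> Prop :=
| oc_refl e : e \in s -> order_closure s R e e
| oc_step e e' : R e e' -> order_closure s R e e'
| oc_trans e f e' :
    order_closure s R e f -> order_closure s R f e' -> order_closure s R e e'.

Definition TO_le s : event T X L -> event T X L -> Prop :=
  order_closure s (fun e e' =>
    tr_le s e e' /\ exists t, t \in event_threads e /\ t \in event_threads e').

Definition HB_le s : event T X L -> event T X L -> Prop :=
  order_closure s (fun e e' =>
    TO_le s e e' \/
    tr_le s e e' /\ exists l : L, opr e = Rel l /\ opr e' = Acq l).

Lemma order_closure_tr_le s R :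
  (forall e e', R e e' -> tr_le s e e') ->
  forall e e', order_closure s R e e' -> tr_le s e e'.
Proof.
move=> RP e e'; elim=> [f fs|f g /RP //|f g h _ [fs gs fg] _ [_ hs gh]] //.
by split=> //; apply: leq_trans gh.
Qed.

Lemma HB_le_tr_le s e e' : HB_le s e e' -> tr_le s e e'.
Proof.
apply: order_closure_tr_le => f f' [|[] //].
by apply: order_closure_tr_le => g g' [].
Qed.

Lemma HB_le_antisym s e e' : HB_le s e e' -> HB_le s e' e -> e = e'.
Proof.
move=> /HB_le_tr_le [es e's le1] /HB_le_tr_le [_ _ le2].
have eqi : index e s = index e' s by apply/eqP; rewrite eqn_leq le1.
by rewrite -(nth_index e es) eqi nth_index.
Qed.

Definition correct_reordering s s' : Prop :=
  [/\ is_trace s',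
      forall t, t \in threads s' -> prefix (proj s' t) (proj s t)
    & forall e x, e \in s' -> opr e = Read x ->
        last e (proj s' (thr e)) != e -> lastWr s' e = lastWr s e].

Definition respects_HB s s' : Prop :=
  forall e e', e \in s -> e' \in s -> HB_le s e e' -> e' \in s' ->
    e \in s' /\ tr_le s' e e'.

Definition is_access e : bool :=
  match opr e with Read _ | Write _ => true | _ => false end.

Definition accesses e (x : X) : Prop := opr e = Read x \/ opr e = Write x.

Definition conflicting e e' : Prop :=
  thr e <> thr e' /\
  exists x, [/\ accesses e x, accesses e' x & opr e = Write x \/ opr e' = Write x].

Definition HB_schedulable_race s e e' : Prop :=
  [/\ conflicting e e', tr_le s e e'
    & exists s', [/\ correct_reordering s s', respects_HB s s'
        & exists s'', is_trace s'' /\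
            (s' = s'' ++ [:: e; e'] \/ s' = s'' ++ [:: e'; e])]].

End Traces.

Section VectorClocks.
Variables T X L : eqType.

(* Vector times of a trace [s] are maps from [threads s] to [nat]; they are
   represented by total functions whose values outside [threads s] are never
   compared. *)
Definition vtime : Type := T -> nat.

Definition vle (ts : seq T) (V1 V2 : vtime) : bool :=
  all (fun t => V1 t <= V2 t) ts.

Definition vjoin (V1 V2 : vtime) : vtime := fun t => maxn (V1 t) (V2 t).

Definition upd (A : eqType) (B : Type) (f : A -> B) (a : A) (b : B) : A -> B :=
  fun a' => if a' == a then b else f a'.

Definition vbot : vtime := fun=> 0.

Record shb_state : Type := ShbState {
  clkC : T -> vtime;
  clkL : L -> vtime;
  clkLW : X -> vtime;
  clkR : X -> vtime;
  clkW : X -> vtime }.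

Definition shb_init : shb_state :=
  ShbState (fun t => upd vbot t 1) (fun=> vbot) (fun=> vbot) (fun=> vbot)
           (fun=> vbot).

Definition tick (C : T -> vtime) (t : T) : T -> vtime :=
  upd C t (upd (C t) t (C t t).+1).

(* The state after processing [e], and whether a race is declared meanwhile;
   [ts] is the set of threads indexing the vector times. *)
Definition shb_step (ts : seq T) (S : shb_state) (e : event T X L) :
    shb_state * bool :=
  let: ShbState C Lk LW R W := S in
  let t := thr e in
  match opr e with
  | Acq l =>
      (ShbState (upd C t (vjoin (C t) (Lk l))) Lk LW R W, false)
  | Rel l =>
      (ShbState (tick C t) (upd Lk l (C t)) LW R W, false)
  | Fork u =>
      (ShbState (tick (upd C u (upd (C t) u 1)) t) Lk LW R W, false)
  | Join u =>
      (ShbState (upd C t (vjoin (C t) (C u))) Lk LW R W, false)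
  | Read x =>
      let C' := upd C t (vjoin (C t) (LW x)) in
      (ShbState C' Lk LW (upd R x (upd (R x) t (C' t t))) W,
       ~~ vle ts (W x) (C t))
  | Write x =>
      (ShbState (tick C t) Lk (upd LW x (C t)) R
                (upd W x (upd (W x) t (C t t))),
       ~~ vle ts (R x) (C t) || ~~ vle ts (W x) (C t))
  end.

Definition shb_run (ts : seq T) (s : seq (event T X L)) : shb_state :=
  foldl (fun S e => (shb_step ts S e).1) shb_init s.

Definition reports_race (s : seq (event T X L)) (e : event T X L) : bool :=
  (shb_step (threads s) (shb_run (threads s) (take (index e s) s)) e).2.

End VectorClocks.

(* Main.v *)
(** Let SHB be the order obtained from HB by adding an edge from the last write
    before each read to that read.  A conflicting pair (e', e) is schedulable
    iff e' is not SHB-below an event of the thread of e that precedes e.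
    - In a correct reordering that respects HB and ends with e' and e, every
      event SHB-below a thread predecessor of e occurs before e, since reads that
      are not the last event of their thread keep their last write; if e' were
      such an event it could not be adjacent to e.
    - Conversely, keep in trace order the events SHB-below the thread
      predecessors of e or of e', then append e' and e.
    The vector clocks decide SHB: with [time f] the local clock of the thread of
    f when f is processed, [time f <= C_t (thr f)] holds iff f is SHB-below an
    event of t processed so far. *)
Require Import Defs.
From mathcomp Require Import all_boot zify.

Set Implicit Arguments.
Unset Strict Implicit.
Unset Printing Implicit Defensive.

(** * Filtering, prefixes and positions in sequences *)

Section Seq.
Variable A : eqType.
Implicit Types (s q : seq A) (D P : pred A).

(** Once one [P]-element fails [D], every later one fails too, so [D] cuts the [P]-elements at a
    single point. In the reordering, [P] selects the events of a thread or the operations of a lock,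
    and [D] is an SHB-downward closed set. *)
Lemma prefix_filter_filter D P s :
  pairwise (fun f g => [==> P f, P g, D g => D f]) s ->
  prefix (filter D (filter P s)) (filter P s).
Proof.
elim: s => [//|f s IHs] /=; case/andP=> /allP Df /IHs IH.
case Pf: (P f) => //=; case Dfe: (D f) => /=; first by rewrite eqxx.
rewrite (_ : filter D (filter P s) = [::]) //.
apply/eqP; rewrite -(negbK (_ == _)) -has_filter; apply/hasPn=> g.
rewrite mem_filter => /andP[Pg gs]; apply/negP => Dg.
by move: (Df g gs); rewrite Pf Pg Dg Dfe.
Qed.

Lemma pairwise_index (r : rel A) s : uniq s ->
  (forall f g, f \in s -> g \in s -> index f s < index g s -> r f g) ->
  pairwise r s.
Proof.
case: s => [//|a s] us H; apply/(pairwiseP a) => i j.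
rewrite !inE => lti ltj ij.
by apply: H; rewrite ?mem_nth ?index_uniq.
Qed.

Lemma take_index_filter D s f : D f ->
  take (index f (filter D s)) (filter D s) = filter D (take (index f s) s).
Proof.
move=> Df; elim: s => [//|a s IHs] /=; case: (eqVneq a f) => [->|af] /=.
  by rewrite Df /= eqxx.
by case: (D a) => //=; rewrite (negPf af) /= IHs.
Qed.

Lemma last_filter_some D q :
  (forall g, last None (map Some q) = Some g -> D g) ->
  last None (map Some (filter D q)) = last None (map Some q).
Proof.
case/lastP: q => [//|q g]; rewrite filter_rcons map_rcons last_rcons => H.
by rewrite (H g) // map_rcons last_rcons.
Qed.

(** The last [P]-element lies in the part of [s] from [h] on, and by uniqueness [f] does not occur
    there. *)
Lemma last_filter_neq P s f h : uniq s -> h \in s -> P h ->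
  index f s < index h s -> last f (filter P s) != f.
Proof.
move=> us hs Ph lt; rewrite -{1}(cat_take_drop (index h s) s) filter_cat.
rewrite last_cat drop_index //= Ph /=; apply/eqP => E.
have: f \in drop (index h s) s.
  rewrite drop_index // -{1}E.
  have := mem_last h (filter P (drop (index h s).+1 s)).
  by rewrite !inE mem_filter => /orP[->//|/andP[_ ->]]; rewrite orbT.
move=> fd; have fs := mem_drop fd.
move: us; rewrite -{1}(cat_take_drop (index h s) s) cat_uniq.
case/and3P=> _ /hasPn/(_ f fd) /=.
by rewrite in_take // lt.
Qed.

Lemma head_filter_neq P s f g : g \in s -> P g ->
  index g s < index f s -> head f (filter P s) != f.
Proof.
move=> gs Pg lt; rewrite -{1}(cat_take_drop (index f s) s) filter_cat.
have: g \in filter P (take (index f s) s) by rewrite mem_filter Pg in_take.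
case E: (filter P _) => [//|h q] _ /=; apply/eqP => hf.
have: f \in filter P (take (index f s) s) by rewrite E hf mem_head.
rewrite mem_filter => /andP[_ ft].
by move: (ft); rewrite in_take ?ltnn // (mem_take ft).
Qed.

Lemma index_lt_neq s f g : f \in s -> f <> g ->
  index f s <= index g s -> index f s < index g s.
Proof.
move=> fs fg; rewrite leq_eqVlt => /orP[/eqP E|//]; case: fg.
by rewrite -(nth_index f fs) E nth_index // -index_mem -E index_mem.
Qed.
End Seq.

(** * Last edges of HB and SHB paths, and the order on lock operations *)

Section Order.
Variables T X L : eqType.
Variable s : seq (event T X L).
Implicit Types (R : event T X L -> event T X L -> Prop).

Lemma thr_event_threads (e : event T X L) : thr e \in event_threads e.
Proof. by rewrite /event_threads; case: (opr e) => *; rewrite inE eqxx. Qed.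

Lemma order_closure_sub R R' :
  (forall f g, R f g -> order_closure s R' f g) ->
  forall f g, order_closure s R f g -> order_closure s R' f g.
Proof.
move=> RR f g; elim=> [h hs|h h' /RR//|h k h' _ IH1 _ IH2].
  exact: oc_refl.
exact: oc_trans IH1 IH2.
Qed.


(** A path between distinct events has a last edge that is not a loop. Cutting the path there
    reduces a statement about [e] to events earlier in the trace. *)
Lemma order_closure_last R f e : (forall g h, R g h -> tr_le s g h) ->
  order_closure s R f e -> f <> e ->
  exists h, [/\ h \in s, index h s < index e s, order_closure s R f h & R h e].
Proof.
move=> Rs; elim=> [//|h h' Rh ne|h k h' hk IH1 kh' IH2 ne].
  have [hs _ le] := Rs _ _ Rh.
  by exists h; split=> //; [exact: index_lt_neq | exact: oc_refl].
have [E|/eqP kh] := eqVneq k h'; first by rewrite -E in ne *; exact: IH1.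
have [m [ms mh km Rm]] := IH2 kh.
by exists m; split=> //; exact: oc_trans hk km.
Qed.

(** Generators of HB in which the nested closure [TO_le] is replaced by its single thread edges, so
    that the last edge of a path is concrete. *)
Definition hb_edge f e : Prop := tr_le s f e /\
  ((exists t, t \in event_threads f /\ t \in event_threads e) \/
   exists l, opr f = Rel l /\ opr e = Acq l).

Lemma HB_leE f e : HB_le s f e -> order_closure s hb_edge f e.
Proof.
apply: order_closure_sub => g h [|[le rel]]; last by apply: oc_step; split; [|right].
by apply: order_closure_sub => g' h' [le thr]; apply: oc_step; split; [|left].
Qed.

Lemma hb_edge_HB_le f e : hb_edge f e -> HB_le s f e.
Proof.
move=> [le [thr|rel]]; apply: oc_step; last by right.
by left; apply: oc_step.
Qed.

Lemma HB_le_thread f g t : f \in s -> g \in s -> index f s <= index g s ->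
  t \in event_threads f -> t \in event_threads g -> HB_le s f g.
Proof.
by move=> fs gs le tf tg; apply: hb_edge_HB_le; split=> //; left; exists t.
Qed.

Definition last_write n (x : X) : option (event T X L) :=
  last None [seq Some f | f <- take n s & opr f == Write x].

Lemma last_write_some n x f : last_write n x = Some f ->
  f \in take n s /\ opr f = Write x.
Proof.
move=> E; have := mem_last None [seq Some f | f <- take n s & opr f == Write x].
rewrite -/(last_write n x) E inE /= => /mapP[g].
by rewrite mem_filter => /andP[/eqP gx gs] [->].
Qed.

Lemma lastWr_read e x : opr e = Read x -> lastWr s e = last_write (index e s) x.
Proof. by rewrite /lastWr => ->. Qed.

Definition shb_edge f e : Prop :=
  hb_edge f e \/ e \in s /\ lastWr s e = Some f.

Definition SHB_le := order_closure s shb_edge.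

Lemma lastWr_some e f : lastWr s e = Some f -> exists x,
  [/\ opr e = Read x, opr f = Write x, f \in s & index f s < index e s].
Proof.
rewrite /lastWr; case E: (opr e) => [x|x|l|l|u|u] //.
case/last_write_some => ft fx; exists x; split=> //; first exact: mem_take ft.
by rewrite -in_take // (mem_take ft).
Qed.

Lemma shb_edge_tr_le f e : shb_edge f e -> tr_le s f e.
Proof.
by case=> [[]//|[es /lastWr_some[x [_ _ fs lt]]]]; split=> //; exact: ltnW.
Qed.

Lemma SHB_le_tr_le f e : SHB_le f e -> tr_le s f e.
Proof. exact: order_closure_tr_le shb_edge_tr_le _ _. Qed.

Lemma HB_le_SHB_le f e : HB_le s f e -> SHB_le f e.
Proof.
by move/HB_leE; apply: order_closure_sub => g h gh; apply: oc_step; left.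
Qed.

(** An access belongs to one thread only and is not an acquire, so the last HB edge into it is a
    thread edge. *)
Lemma HB_le_access f e : is_access e -> HB_le s f e -> f <> e ->
  exists h, [/\ h \in s, index h s < index e s, thr e \in event_threads h
               & HB_le s f h].
Proof.
move=> ae /HB_leE fe ne.
have [h [hs he fh]] := order_closure_last (fun g h (gh : hb_edge g h) => gh.1) fe ne.
case=> _ edge; exists h; split=> //; last first.
  by move: fh; apply: order_closure_sub => g k; apply: hb_edge_HB_le.
move: ae edge; rewrite /is_access /event_threads.
by case: (opr e) => // x _ [[t [th]]|[l []//]]; rewrite inE => /eqP <-.
Qed.

(** The common meaning of the clocks after [n] events: [P] is taken to be the events of a thread for
    [clkC], the releases of a lock for [clkL], and the current last write of a location for
    [clkLW]. *)
Definition seen n (P : pred (event T X L)) f : Prop :=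
  exists g, [/\ g \in s, index g s < n, P g & SHB_le f g].

Definition on_thread t : pred (event T X L) := fun g => t \in event_threads g.

Lemma seenS e P f : e \in s ->
  seen (index e s).+1 P f <-> seen (index e s) P f \/ P e /\ SHB_le f e.
Proof.
move=> es; split=> [[g [gs]]|[[g [gs ge Pg fg]]|[Pe fe]]].
- rewrite ltnS => le Pg fg; have [E|/eqP ne] := eqVneq g e.
    by rewrite E in Pg fg; right.
  by left; exists g; split=> //; exact: index_lt_neq.
- by exists g; split=> //; exact: ltnW.
- by exists e.
Qed.

Lemma seen_lt n P f : seen n P f -> index f s < n.
Proof. by move=> [g [_ gn _ /SHB_le_tr_le[_ _ le]]]; exact: leq_ltn_trans gn. Qed.

Lemma seen_self n t f : f \in s -> index f s < n -> t \in event_threads f ->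
  seen n (on_thread t) f.
Proof. by move=> fs fn tf; exists f; split=> //; exact: oc_refl. Qed.

Lemma SHB_le_seen e f : e \in s -> f <> e -> SHB_le f e <->
  [\/ exists2 t, t \in event_threads e & seen (index e s) (on_thread t) f,
      exists2 l, opr e = Acq l & seen (index e s) (fun g => opr g == Rel l) f
    | exists2 x, opr e = Read x
      & seen (index e s) (fun g => last_write (index e s) x == Some g) f].
Proof.
move=> es ne; split=> [fe|].
  have [h [hs he fh [[_ [[t [th te]]|[l [hl el]]]]|[_ hw]]]] :=
    order_closure_last shb_edge_tr_le fe ne.
  - by constructor 1; exists t => //; exists h.
  - by constructor 2; exists l => //; exists h; rewrite hl.
  have [x [ex _ _ _]] := lastWr_some hw.
  by constructor 3; exists x => //; exists h; rewrite -(lastWr_read ex) hw eqxx.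
case=> [[t te]|[l el]|[x ex]] [g [gs ge Pg fg]]; apply: oc_trans fg _; apply: oc_step.
- by left; split; [split=> //; exact: ltnW | left; exists t].
- left; split; [split=> //; exact: ltnW | right; exists l].
  by split=> //; apply/eqP.
by right; split=> //; rewrite (lastWr_read ex); apply/eqP.
Qed.

(** Consecutive operations on one lock are either by the same thread or a release followed by an
    acquire. Both are HB edges, and they chain. *)
Lemma lock_order l f g : uniq s -> lock_wf s -> f \in s -> g \in s ->
  is_lock_op l (opr f) -> is_lock_op l (opr g) -> index f s <= index g s ->
  HB_le s f g.
Proof.
move=> us wf fs gs fl gl; rewrite leq_eqVlt => /orP[/eqP E|lt].
  by rewrite -(nth_index f fs) E nth_index //; exact: oc_refl.
pose q := [seq e <- s | is_lock_op l (opr e)].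
pose r (a b : event T X L) :=
  (thr a == thr b) || (opr a == Rel l) && (opr b == Acq l).
have rq : sorted r q.
  (* The string is consumed one acquire-release block at a time: inside a block the thread is the
     same, and between blocks a release meets an acquire. *)
  have [ts] := wf l; rewrite -/q; elim: ts q => [|t ts IH] [|a [|b q]] //=.
  case/andP=> /eqP[ta oa] /andP[/eqP[tb ob]] pq.
  rewrite {1}/r ta tb eqxx /=; have := IH _ pq.
  case: q pq => [//|c q] /=; case: ts {IH} => [//|t' ts] /=.
  by case/andP=> /eqP[tc oc] _ ->; rewrite /r ob oc !eqxx orbT.
have uq : uniq q by exact: filter_uniq.
have memq e : (e \in q) = is_lock_op l (opr e) && (e \in s) by rewrite mem_filter.
have pq : pairwise (fun a b => index a s < index b s) q.
  apply: pairwise_filter; exact: pairwise_index.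
have fq : f \in q by rewrite memq fl.
have gq : g \in q by rewrite memq gl.
have step i : i.+1 < size q -> HB_le s (nth f q i) (nth f q i.+1).
  move=> lti; have := mem_nth f lti; have := mem_nth f (ltnW lti).
  rewrite !memq => /andP[_ as_] /andP[_ bs].
  have le : index (nth f q i) s < index (nth f q i.+1) s.
    by move/(pairwiseP f): pq; apply=> //; rewrite inE ltnW.
  apply: hb_edge_HB_le; split; first by split=> //; exact: ltnW.
  have /orP[/eqP E|/andP[/eqP ra /eqP ab]] : r (nth f q i) (nth f q i.+1).
  - by move/(sortedP f): rq; apply.
  - by left; exists (thr (nth f q i)); rewrite {2}E !thr_event_threads.
  - by right; exists l.
have chain i j : i <= j -> j < size q -> HB_le s (nth f q i) (nth f q j).
  elim: j => [|j IH].
    rewrite leqn0 => /eqP -> lt0; apply: oc_refl.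
    by have := mem_nth f lt0; rewrite memq => /andP[].
  rewrite leq_eqVlt => /orP[/eqP -> ltj|].
    apply: oc_refl; by have := mem_nth f ltj; rewrite memq => /andP[].
  rewrite ltnS => ij ltj; apply: oc_trans (step _ ltj); exact: IH (ltnW ltj).
rewrite -(nth_index f fq) -(nth_index f gq); apply: chain; last by rewrite index_mem.
rewrite leqNgt; apply/negP => lt'; move/(pairwiseP f): pq => /(_ _ _ _ _ lt').
by rewrite !inE !index_mem !nth_index // => /(_ gq fq); rewrite ltnNge ltnW.
Qed.
End Order.

(** * The vector clocks decide SHB *)

(** Splits on the equality tests coming from [upd], then discharges the guard of each implication
    among the hypotheses by [congruence] or drops that hypothesis, leaving arithmetic facts for
    [lia]. *)
Ltac split_eqs := repeat (case: eqVneq => [?|/eqP ?]; subst => //=);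
  repeat match goal with
  | H : ?P -> ?Q |- _ =>
      match type of P with Prop => first [specialize (H ltac:(congruence)) | clear H] end
  end; try congruence.

Section Clocks.
Variables T X L : eqType.
Variable s : seq (event T X L).
Hypothesis s_uniq : uniq s.
Hypothesis s_lock : lock_wf s.
Hypothesis s_fork_join : fork_join_wf s.

Definition state n := shb_run (threads s) (take n s).

Definition time f := clkC (state (index f s)) (thr f) (thr f).

Definition unjoined n t : Prop :=
  forall g, g \in s -> index g s < n -> opr g <> Join t.

Definition unstarted n t : Prop :=
  forall g, g \in s -> index g s < n -> t \notin event_threads g.

Lemma stateS e : e \in s ->
  state (index e s).+1 = (shb_step (threads s) (state (index e s)) e).1.
Proof.
move=> es; rewrite /state (take_nth e) ?index_mem // nth_index //.
by rewrite /shb_run foldl_rcons.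
Qed.

Lemma unjoined_lt n m t : m <= n -> unjoined n t -> unjoined m t.
Proof. by move=> le H g gs lt; apply: H => //; exact: leq_trans le. Qed.

Lemma unjoined_index e t : e \in s -> t \in event_threads e ->
  unjoined (index e s) t.
Proof.
move=> es te g gs lt gj; have [_ /(_ gj) /eqP] := s_fork_join t gs.
by apply/negP; exact: (last_filter_neq s_uniq es).
Qed.

Lemma unstarted_fork e u : e \in s -> opr e = Fork u -> unstarted (index e s) u.
Proof.
move=> es ef g gs lt; apply/negP => ug.
have [/(_ ef) /eqP + _] := s_fork_join u es.
by apply/negP; exact: (head_filter_neq gs).
Qed.

Lemma last_writeS e x : e \in s -> last_write s (index e s).+1 x =
  if opr e == Write x then Some e else last_write s (index e s) x.
Proof.
move=> es; rewrite /last_write (take_nth e) ?index_mem // nth_index //.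
by rewrite filter_rcons; case: ifP => // _; rewrite map_rcons last_rcons.
Qed.

Lemma unstarted_seen n u f : unstarted n u -> ~ seen s n (on_thread u) f.
Proof. by move=> nu [g [gs gn ug _]]; move/negP: (nu g gs gn); apply. Qed.

(* [C_t] is no longer meaningful after [join(t)], which is an event of [t] that
   does not update it; no further event of [t] can occur then. *)
Record inv n : Prop := Inv {
  inv_own t : unjoined n t ->
    [/\ forall v, v != t -> clkC (state n) v t < clkC (state n) t t,
        forall l, clkL (state n) l t < clkC (state n) t t
      & forall x, clkLW (state n) x t < clkC (state n) t t];
  inv_start t : unstarted n t -> clkC (state n) t t = 1;
  inv_C t f : unjoined n t -> f \in s -> index f s < n ->
    time f <= clkC (state n) t (thr f) <-> seen s n (on_thread t) f;
  inv_L l f : f \in s -> index f s < n ->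
    time f <= clkL (state n) l (thr f) <->
    seen s n (fun g => opr g == Rel l) f;
  inv_LW x f : f \in s -> index f s < n ->
    time f <= clkLW (state n) x (thr f) <->
    seen s n (fun g => last_write s n x == Some g) f;
  inv_R x t k : clkR (state n) x t <= k <->
    forall f, f \in s -> index f s < n -> opr f = Read x -> thr f = t ->
      time f <= k;
  inv_W x t k : clkW (state n) x t <= k <->
    forall f, f \in s -> index f s < n -> opr f = Write x -> thr f = t ->
      time f <= k
}.

Lemma inv0 : inv 0.
Proof.
split; rewrite /state take0 //=.
- by move=> t _; split=> [v vt|l|x]; rewrite /upd eqxx // eq_sym (negPf vt).
- by move=> t _; rewrite /upd eqxx.
Qed.

(** * Preservation of the clock invariant by one event *)

Section Step.
Variable e : event T X L.
Hypothesis es : e \in s.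
Hypothesis IH : inv (index e s).
Local Notation n := (index e s).

Let own_t := inv_own IH (unjoined_index es (thr_event_threads e)).

(* Strictness is what makes an event invisible to other clocks until its thread
   ticks, that is, until it executes a release, fork or write. *)
Lemma step_own t : unjoined n.+1 t ->
    [/\ forall v, v != t -> clkC (state n.+1) v t < clkC (state n.+1) t t,
        forall l, clkL (state n.+1) l t < clkC (state n.+1) t t
      & forall x, clkLW (state n.+1) x t < clkC (state n.+1) t t].
Proof.
move=> ut; have [oC oL oW] := inv_own IH (unjoined_lt (leqnSn _) ut).
have {}oC v : v <> t -> clkC (state n) v t < clkC (state n) t t by move/eqP/oC.
have [oC' oL' oW'] := own_t; rewrite stateS // /shb_step.
have {}oC' v : v <> thr e ->
  clkC (state n) v (thr e) < clkC (state n) (thr e) (thr e) by move/eqP/oC'.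
have ej := ut e es (leqnn _).
(* A fork sets the own entry of the forked thread to 1. It was 1 already, so the strict bounds on
   the other clocks survive. *)
have start : opr e = Fork t -> clkC (state n) t t = 1.
  by move=> ef; apply: inv_start => //; exact: unstarted_fork.
case: (state n) oC oL oW start oC' oL' oW' => C Lk LW R W /= oC oL oW start oC' oL' oW'.
have oCe := oC (thr e).
case Eop: (opr e) start ej => [x|x|l|l|u|u] start ej /=;
  split=> [v /eqP vt|l'|x']; rewrite /tick /upd /vjoin;
  try have oCv := oC v; try have oCv' := oC' v;
  try have oCu := oC u; try have oCu' := oC' u;
  try have oLl' := oL l'; try have oWx' := oW x';
  try have oLl := oL l; try have oWx := oW x;
  try have oLl'' := oL' l'; try have oWx'' := oW' x'.
all: split_eqs; lia.
Qed.

Lemma step_start t : unstarted n.+1 t -> clkC (state n.+1) t t = 1.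
Proof.
move=> ut; have : clkC (state n) t t = 1.
  by apply: inv_start => // g gs lt; apply: ut => //; exact: ltnW.
have := ut e es (leqnn _); rewrite stateS // /shb_step /event_threads.
case: (state n) => C Lk LW R W /=.
by case: (opr e) => [x|x|l|l|u|u]; rewrite /= !inE ?negb_or /tick /upd;
  repeat (case: eqVneq => ?; subst=> //=).
Qed.

Lemma time_le f : f \in s -> index f s < n -> thr f = thr e ->
  time f <= clkC (state n) (thr e) (thr e).
Proof.
move=> fs fn fe; have ut := unjoined_index es (thr_event_threads e).
rewrite -{2}fe (inv_C IH) //.
by apply: seen_self => //; rewrite -fe thr_event_threads.
Qed.

(** The right-hand side is the entry of [thr f] in the clock of [thr e] after the joins at [e] and
    before its tick. Each operand of a maximum accounts for one kind of last edge into [e]. *)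
Lemma SHB_le_clock f : f \in s -> index f s < n -> SHB_le s f e <->
  time f <= match opr e with
    | Acq l => maxn (clkC (state n) (thr e) (thr f)) (clkL (state n) l (thr f))
    | Read x =>
        maxn (clkC (state n) (thr e) (thr f)) (clkLW (state n) x (thr f))
    | Join u => maxn (clkC (state n) (thr e) (thr f)) (clkC (state n) u (thr f))
    | _ => clkC (state n) (thr e) (thr f)
    end.
Proof.
move=> fs fn; have ne : f <> e by move=> E; rewrite E ltnn in fn.
have IC v : v \in event_threads e ->
    time f <= clkC (state n) v (thr f) <-> seen s n (on_thread v) f.
  by move=> /(unjoined_index es) uv; exact: inv_C.
have IL l := inv_L IH l fs fn; have ILW x := inv_LW IH x fs fn.
rewrite (SHB_le_seen es ne); split=> [[[v ve sv]|[l E sl]|[x E sx]]|].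
- have := ve; rewrite {1}/event_threads; have /IC ICv := ve.
  case E: (opr e) => [x|x|l|l|u|u]; rewrite !inE; do ?[case/orP];
    move=> /eqP vE; subst v; rewrite ?leq_max; do ?[by apply/ICv];
    do ?[by apply/orP; left; apply/ICv]; do ?[by apply/orP; right; apply/ICv].
  (* The remaining case is the thread forked by [e], which has no earlier event through which [f]
     could be seen. *)
  by case: (unstarted_seen (unstarted_fork es E) sv).
- by rewrite E leq_max; apply/orP; right; apply/IL.
- by rewrite E leq_max; apply/orP; right; apply/ILW.
have := IC _ (thr_event_threads e).
case E: (opr e) => [x|x|l|l|u|u] ICe; rewrite ?leq_max.
- case/orP=> [/ICe|/ILW]; [constructor 1|constructor 3; exists x] => //.
  by exists (thr e); rewrite ?thr_event_threads.
- by move/ICe; constructor 1; exists (thr e); rewrite ?thr_event_threads.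
- case/orP=> [/ICe|/IL]; [constructor 1|constructor 2; exists l] => //.
  by exists (thr e); rewrite ?thr_event_threads.
- by move/ICe; constructor 1; exists (thr e); rewrite ?thr_event_threads.
- by move/ICe; constructor 1; exists (thr e); rewrite ?thr_event_threads.
have ue : u \in event_threads e by rewrite /event_threads E !inE eqxx orbT.
case/orP=> [/ICe|/(IC u ue)] H; constructor 1; last by exists u.
by exists (thr e); rewrite ?thr_event_threads.
Qed.

Lemma SHB_le_thread f t : f \in s -> index f s <= n ->
  t \in event_threads f -> t \in event_threads e -> SHB_le s f e.
Proof. by move=> fs le tf te; apply/HB_le_SHB_le/(HB_le_thread _ _ _ tf). Qed.

(** If [t] is a thread of [e], all earlier events of [t] are SHB-below [e], so for earlier [f] being
    seen by [t] becomes [SHB_le s f e], which [SHB_le_clock] decides. Otherwise the clock of [t]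
    does not change. *)
Lemma step_C t f : unjoined n.+1 t -> f \in s -> index f s < n.+1 ->
  time f <= clkC (state n.+1) t (thr f) <-> seen s n.+1 (on_thread t) f.
Proof.
move=> ut fs; rewrite ltnS => le; rewrite seenS //.
have ej := ut e es (leqnn _).
have {}ut := unjoined_lt (leqnSn _) ut.
(* For [f = e], the strict bounds of [inv_own] keep the clocks of threads not involved in [e] below
   [time e]. *)
have [fe|/eqP fe] := eqVneq f e.
  rewrite {}fe in fs le *.
  have -> : seen s n (on_thread t) e \/ on_thread t e /\ SHB_le s e e <->
      t \in event_threads e.
    split=> [[/seen_lt|[]//]|te]; first by rewrite ltnn.
    by right; split=> //; exact: oc_refl.
  rewrite /time stateS // /shb_step /event_threads.
  have [oC oL oW] := own_t.
  have {}oC : t <> thr e ->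
    clkC (state n) t (thr e) < clkC (state n) (thr e) (thr e) by move/eqP/oC.
  have start : opr e = Fork (thr e) -> clkC (state n) (thr e) (thr e) = 1.
    by move=> ef; apply: inv_start => //; exact: unstarted_fork.
  move: oC oL oW start; case: (state n) => C Lk LW R W /= oC oL oW start.
  case: (opr e) ej start => [x|x|l|l|u|u] ej start;
    rewrite /= !inE /tick /upd /vjoin;
    try have oLl := oL l; try have oWx := oW x; split_eqs; lia.
have fn : index f s < n by exact: index_lt_neq.
case te: (t \in event_threads e); last first.
  have -> : clkC (state n.+1) t = clkC (state n) t.
    move: te; rewrite stateS // /shb_step /event_threads.
    case: (state n) => C Lk LW R W /=.
    case: (opr e) => [x|x|l|l|u|u]; rewrite /= !inE /tick /upd;
      repeat (case: eqVneq => ?; subst=> //=).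
  rewrite (inv_C IH) //; split=> [|[//|[]]]; first by left.
  by rewrite /on_thread te.
have -> : seen s n (on_thread t) f \/ on_thread t e /\ SHB_le s f e <->
    SHB_le s f e.
  split=> [[[g [gs ge gt fg]]|[//]]|]; last by right.
  apply: oc_trans fg _; exact: (SHB_le_thread gs (ltnW ge) gt).
rewrite (SHB_le_clock fs fn).
have tl := time_le fs fn.
move: te tl; rewrite stateS // /shb_step /event_threads.
(* The entry reset to 1 by a fork is therefore never the entry of [thr f]. *)
have : forall u, opr e = Fork u -> thr f <> u.
  move=> u eu fu; have := unstarted_fork es eu fs fn.
  by rewrite -fu thr_event_threads.
case: (state n) => C Lk LW R W /=; move: (thr f) (time f) => w k.
case: (opr e) ej => [x|x|l|l|u|u] ej uf; rewrite /= !inE /tick /upd /vjoin => te tl;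
  try have ufu := uf u erefl; clear uf; move: te; split_eqs; lia.
Qed.

(** A release overwrites the clock of the lock, but loses nothing: by [lock_order] all earlier
    releases of [l] are HB-below it. *)
Lemma step_L l f : f \in s -> index f s < n.+1 ->
  time f <= clkL (state n.+1) l (thr f) <->
  seen s n.+1 (fun g => opr g == Rel l) f.
Proof.
move=> fs; rewrite ltnS => le; rewrite seenS //.
have [fe|/eqP fe] := eqVneq f e.
  rewrite {}fe in fs le *.
  have -> : seen s n (fun g => opr g == Rel l) e \/
      opr e == Rel l /\ SHB_le s e e <-> opr e = Rel l.
    split=> [[/seen_lt|[/eqP//]]|/eqP te]; first by rewrite ltnn.
    by right; split=> //; exact: oc_refl.
  rewrite /time stateS // /shb_step.
  have [_ oL _] := own_t; have {oL} := oL l.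
  case: (state n) => C Lk LW R W /=.
  case: (opr e) => [x|x|l'|l'|u|u] /= oL; try by split=> //; lia.
  rewrite /upd; case: eqVneq => [->|ne]; first by split.
  by split=> [|[E]]; [lia | rewrite E eqxx in ne].
have fn : index f s < n by exact: index_lt_neq.
have IL := inv_L IH l fs fn.
case re: (opr e == Rel l); last first.
  have -> : clkL (state n.+1) l = clkL (state n) l.
    move: re; rewrite stateS // /shb_step; case: (state n) => C Lk LW R W /=.
    by case: (opr e) => //= l'; rewrite /upd; case: (eqVneq l l') => // ->; rewrite eqxx.
  by rewrite IL; split=> [|[//|[]//]]; left.
move/eqP: re => re.
have -> : seen s n (fun g => opr g == Rel l) f \/ true /\ SHB_le s f e <->
    SHB_le s f e.
  split=> [[[g [gs ge /eqP gt fg]]|[//]]|]; last by right.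
  apply: oc_trans fg _; apply: HB_le_SHB_le.
  by apply: (lock_order (l := l)) => //; rewrite /is_lock_op ?gt ?re ?eqxx ?orbT // ltnW.
rewrite (SHB_le_clock fs fn) stateS // /shb_step re.
by case: (state n) => C Lk LW R W /=; rewrite /upd eqxx.
Qed.

(** A write of [x] becomes the only last write of [x], so overwriting forgets exactly what is no
    longer seen through it. *)
Lemma step_LW x f : f \in s -> index f s < n.+1 ->
  time f <= clkLW (state n.+1) x (thr f) <->
  seen s n.+1 (fun g => last_write s n.+1 x == Some g) f.
Proof.
move=> fs; rewrite ltnS => le; rewrite seenS // last_writeS //.
have [we|/eqP we] := eqVneq (opr e) (Write x).
  have -> : clkLW (state n.+1) x = clkC (state n) (thr e).
    rewrite stateS // /shb_step we; case: (state n) => C Lk LW R W /=.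
    by rewrite /upd eqxx.
  have -> : seen s n (fun g => Some e == Some g) f \/
      Some e == Some e /\ SHB_le s f e <-> SHB_le s f e.
    split=> [[[g [_ + /eqP[eg] _]]|[]//]|]; first by rewrite -eg ltnn.
    by right.
  have [->|/eqP fe] := eqVneq f e.
    by rewrite /time leqnn; split=> // _; exact: oc_refl.
  have fn : index f s < n by exact: index_lt_neq.
  by rewrite (SHB_le_clock fs fn) we.
have -> : clkLW (state n.+1) x = clkLW (state n) x.
  move: we; rewrite stateS // /shb_step; case: (state n) => C Lk LW R W /=.
  by case: (opr e) => //= x' ne; rewrite /upd; case: eqVneq => // E; rewrite E in ne.
have -> : seen s n (fun g => last_write s n x == Some g) f \/
    last_write s n x == Some e /\ SHB_le s f e <->
    seen s n (fun g => last_write s n x == Some g) f.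
  split=> [[//|[/eqP/last_write_some[ei _]]]|]; last by left.
  by rewrite in_take // ltnn in ei.
have [fe|/eqP fe] := eqVneq f e.
  rewrite {}fe in fs le *; split=> [|/seen_lt]; last by rewrite ltnn.
  by have [_ _ oW] := own_t; rewrite /time leqNgt oW.
by apply: inv_LW => //; exact: index_lt_neq.
Qed.

(** The entry is described by its upper bounds, as a maximum of times of reads. A new read may
    overwrite it because, by [time_le], earlier events of its thread have no larger time. *)
Lemma step_R x t k : clkR (state n.+1) x t <= k <->
  forall f, f \in s -> index f s < n.+1 -> opr f = Read x -> thr f = t ->
    time f <= k.
Proof.
have [[re te]|ne] : (opr e = Read x /\ thr e = t) \/ ~ (opr e = Read x /\ thr e = t).
  have [re|/eqP re] := eqVneq (opr e) (Read x); last by right=> -[].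
  by have [te|/eqP te] := eqVneq (thr e) t; [left|right=> -[]].
  have -> : clkR (state n.+1) x t = time e.
    have [_ _ oW] := own_t; have {}oW := oW x.
    move: oW; rewrite stateS // /shb_step re /time.
    case: (state n) => C Lk LW R W /= oW.
    by rewrite /upd te !eqxx /vjoin -te; apply/maxn_idPl; exact: ltnW.
  split=> [tk f fs fn rf tf|]; last by apply.
  apply: leq_trans tk; have [->//|/eqP fe] := eqVneq f e.
  rewrite {2}/time; apply: time_le; rewrite ?te //.
  by apply: index_lt_neq.
have -> : clkR (state n.+1) x t = clkR (state n) x t.
  move: ne; rewrite stateS // /shb_step; case: (state n) => C Lk LW R W /=.
  case: (opr e) => //= x' ne; rewrite /upd; case: (eqVneq x x') => // xx'.
  case: (eqVneq t (thr e)) => [E|_]; last by rewrite xx'.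
  by case: ne; rewrite xx' E.
rewrite (inv_R IH); split=> H f fs fn rf tf; last by apply: H => //; exact: ltnW.
apply: H => //; apply: index_lt_neq => // fe; apply: ne.
by rewrite -fe.
Qed.

Lemma step_W x t k : clkW (state n.+1) x t <= k <->
  forall f, f \in s -> index f s < n.+1 -> opr f = Write x -> thr f = t ->
    time f <= k.
Proof.
have [[re te]|ne] : (opr e = Write x /\ thr e = t) \/ ~ (opr e = Write x /\ thr e = t).
  have [re|/eqP re] := eqVneq (opr e) (Write x); last by right=> -[].
  by have [te|/eqP te] := eqVneq (thr e) t; [left|right=> -[]].
  have -> : clkW (state n.+1) x t = time e.
    rewrite stateS // /shb_step re /time; case: (state n) => C Lk LW R W /=.
    by rewrite /upd te !eqxx.
  split=> [tk f fs fn rf tf|]; last by apply.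
  apply: leq_trans tk; have [->//|/eqP fe] := eqVneq f e.
  rewrite {2}/time; apply: time_le; rewrite ?te //.
  by apply: index_lt_neq.
have -> : clkW (state n.+1) x t = clkW (state n) x t.
  move: ne; rewrite stateS // /shb_step; case: (state n) => C Lk LW R W /=.
  case: (opr e) => //= x' ne; rewrite /upd; case: (eqVneq x x') => // xx'.
  case: (eqVneq t (thr e)) => [E|_]; last by rewrite xx'.
  by case: ne; rewrite xx' E.
rewrite (inv_W IH); split=> H f fs fn rf tf; last by apply: H => //; exact: ltnW.
apply: H => //; apply: index_lt_neq => // fe; apply: ne.
by rewrite -fe.
Qed.
End Step.

Lemma invP n : n <= size s -> inv n.
Proof.
elim: n => [_|n IH lt]; first exact: inv0.
have {}IH := IH (ltnW lt).
have [e es E] : exists2 e, e \in s & n = index e s.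
  have [e0 _] : {e0 | e0 \in s} by case: s lt => [//|e0 s' _]; exists e0; exact: mem_head.
  by exists (nth e0 s n); [exact: mem_nth | rewrite index_uniq].
rewrite {}E in IH *.
split; [exact: step_own | exact: step_start | exact: step_C | exact: step_L
       | exact: step_LW | exact: step_R | exact: step_W].
Qed.

(* A boolean test for [seen (index e s) (on_thread (thr e)) f], so that the
   reordering below can be built by filtering. *)
Definition precedes e f :=
  (index f s < index e s) && (time f <= clkC (state (index e s)) (thr e) (thr f)).

Lemma precedesP e f : e \in s -> f \in s ->
  precedes e f <-> seen s (index e s) (on_thread (thr e)) f.
Proof.
move=> es fs; rewrite /precedes; case: ltnP => [fn|le] /=.
  have I := invP (index_size e s).
  exact: (inv_C I (unjoined_index es (thr_event_threads e)) fs fn).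
by split=> // /seen_lt; rewrite ltnNge le.
Qed.

(** If no access [o] of thread [u] were later than [V u], then [V u] would be an upper bound of
    their times, hence of [Z u]. A failing entry thus has an access as witness. *)
Lemma not_vle_access (o : op T X L) n (Z V : vtime T) :
  (forall t k, Z t <= k <-> forall f, f \in s -> index f s < n -> opr f = o ->
     thr f = t -> time f <= k) ->
  ~~ vle (threads s) Z V <->
  exists f, [/\ f \in s, index f s < n, opr f = o & ~~ (time f <= V (thr f))].
Proof.
move=> HZ; split=> [/allPn[u us ZV]|[f [fs fn fo fV]]].
  pose late f := [&& index f s < n, opr f == o, thr f == u & ~~ (time f <= V u)].
  case: (boolP (has late s)) => [/hasP[f fs]|/hasPn H].
    by case/and4P=> fn /eqP fo /eqP <- fV; exists f.
  case/negP: ZV; apply/HZ => f fs fn fo fu; have := H f fs.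
  by rewrite /late fn fo fu !eqxx /= negbK.
apply/allPn; exists (thr f); last first.
  by apply: contra fV => /HZ; apply.
by apply/flattenP; exists (event_threads f);
  [exact: map_f | exact: thr_event_threads].
Qed.

(** The tests also compare the entry of [thr e], but it never fails, by [time_le]. Hence a failing
    entry always comes from a conflicting access. *)
Lemma reports_raceE e : e \in s -> is_access e -> reports_race s e <->
  exists f, [/\ f \in s, index f s < index e s, conflicting f e & ~~ precedes e f].
Proof.
move=> es ae; have I := invP (index_size e s).
have vR x := not_vle_access (clkC (state (index e s)) (thr e)) (inv_R I x).
have vW x := not_vle_access (clkC (state (index e s)) (thr e)) (inv_W I x).
have thr_ne f : f \in s -> index f s < index e s ->
    ~~ (time f <= clkC (state (index e s)) (thr e) (thr f)) -> thr f <> thr e.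
  by move=> fs fn fV fe; rewrite fe (time_le es I) in fV.
have race_def : reports_race s e = match opr e with
    | Read x =>
        ~~ vle (threads s) (clkW (state (index e s)) x)
             (clkC (state (index e s)) (thr e))
    | Write x =>
        ~~ vle (threads s) (clkR (state (index e s)) x)
             (clkC (state (index e s)) (thr e)) ||
        ~~ vle (threads s) (clkW (state (index e s)) x)
             (clkC (state (index e s)) (thr e))
    | _ => false
    end.
  rewrite /reports_race -/(state _) /shb_step.
  by case: (state _) => C Lk LW R W; case: (opr e).
rewrite race_def; case Eop: (opr e) (ae) => [x|x|l|l|u|u];
  rewrite ?/is_access ?Eop // => _; split.
- case/vW=> f [fs fn fx fV]; exists f; rewrite /precedes fn /=.
  by split=> //; split; [exact: thr_ne | exists x; split; [right|left|left]].
- case=> f [fs fn [_ [y [_ ey fy]]]]; rewrite /precedes fn /= => fV.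
  rewrite /accesses Eop in ey fy; case: ey => // -[xy]; case: fy => // fy.
  by apply/vW; exists f; rewrite xy.
- move=> race; have [f [fs fn fx fV]] : exists f, [/\ f \in s, index f s < index e s,
      accesses f x & ~~ (time f <= clkC (state (index e s)) (thr e) (thr f))].
    case/orP: race => [/vR|/vW] [f [fs fn fx fV]]; exists f; split=> //.
      by left.
    by right.
  exists f; rewrite /precedes fn; split=> //; split; first exact: thr_ne.
  by exists x; split=> //; right.
- case=> f [fs fn [_ [y [fy ey _]]]]; rewrite /precedes fn /= => fV.
  rewrite /accesses Eop in ey; case: ey => // -[xy]; rewrite -{}xy in fy.
  by apply/orP; case: fy => fy; [left; apply/vR | right; apply/vW]; exists f.
Qed.
End Clocks.

(** * Schedulable races *)

Section Schedulable.
Variables T X L : eqType.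
Variable s : seq (event T X L).

Lemma event_threads_access (e : event T X L) : is_access e ->
  event_threads e = [:: thr e].
Proof. by rewrite /is_access /event_threads; case: (opr e). Qed.

Lemma accesses_is_access (e : event T X L) x : accesses e x -> is_access e.
Proof. by rewrite /is_access => -[] ->. Qed.

(* A read that has a later event of its thread in [s'] is bound to the same last
   write in a correct reordering [s'] of [s]. *)
Definition fixed_in (s' : seq (event T X L)) f : Prop :=
  f \in s' /\ forall x, opr f = Read x -> exists h,
    [/\ h \in s', index f s' < index h s' & thr f \in event_threads h].

(** The SHB path is followed backwards from [g]. An HB edge is respected, and if its source is a
    read it is a thread edge, so its target fixes that read. A last-write edge survives because its
    target is a fixed read. *)
Lemma SHB_le_reordering s' f g : correct_reordering s s' -> respects_HB s s' ->
  SHB_le s f g -> fixed_in s' g -> fixed_in s' f /\ index f s' <= index g s'.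
Proof.
move=> [[/map_uniq us' _] _ reads] resp.
elim=> [//|h k edge [ks' kr]|h k h' _ IH1 _ IH2 /IH2[/IH1[fh hk] kh']]; last first.
  by split=> //; exact: leq_trans kh'.
have [->|/eqP hk] := eqVneq h k; first by [].
case: edge => [he|[ks lw]].
  have [[hs ks _] edge] := he; have := hb_edge_HB_le he.
  move/(resp _ _ hs ks)/(_ ks') => [hs' [_ _ le]]; split=> //; split=> // x hx.
  exists k; split=> //; first exact: index_lt_neq.
  case: edge => [[t [th tk]]|[l [hl _]]]; last by rewrite hl in hx.
  by move: th; rewrite event_threads_access /is_access ?hx // inE => /eqP <-.
have [x [kx hx hs lt]] := lastWr_some lw.
have [m [ms' km tm]] := kr x kx.
have := reads k x ks' kx; rewrite lw => rk.
have /rk/lastWr_some[y [_ _ hs' /ltnW le]] : last k (proj s' (thr k)) != k.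
  exact: (last_filter_neq us' ms').
by split=> //; split=> // z hz; rewrite hz in hx.
Qed.

Lemma schedulable_not_seen f e : f \in s -> e \in s ->
  HB_schedulable_race s f e ->
  ~ seen s (index e s) (on_thread (thr e)) f.
Proof.
move=> fs es [[fe_thr [x [fx ex _]]] _ [s' [cr resp [s'' [_ Es']]]]].
move=> [g [gs ge eg fg]].
have us' : uniq s' by case: cr => -[/map_uniq].
have [fs' es'] : f \in s' /\ e \in s'.
  by case: Es' => ->; rewrite !mem_cat !inE !eqxx !orbT.
have gHe : HB_le s g e.
  by apply: (HB_le_thread gs es (ltnW ge) eg); exact: thr_event_threads.
have [gs' [_ _ ge']] := resp _ _ gs es gHe es'.
have ne : g <> e by move=> E; rewrite E ltnn in ge.
have {}ge' := index_lt_neq gs' ne ge'.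
have fixg : fixed_in s' g.
  split=> // y gy; exists e; split=> //.
  move: eg; rewrite /on_thread event_threads_access /is_access ?gy // inE => /eqP <-.
  exact: thr_event_threads.
have [_ le] := SHB_le_reordering cr resp fg fixg.
have fg_ne : f <> g.
  move=> E; move: eg; rewrite -E /on_thread event_threads_access.
    by rewrite inE => /eqP/esym.
  exact: accesses_is_access fx.
have lt := index_lt_neq fs' fg_ne le.
have [fs'' sz] : f \notin s'' /\ size s' = (size s'').+2.
  split; last by case: Es' => ->; rewrite size_cat addn2.
  by case: Es' us' => ->; rewrite cat_uniq /= !negb_or -!andbA; case/and5P.
(* [f] occupies one of the last two positions of [s'], which leaves no room for [g] strictly after
   [f] and strictly before [e]. *)
have : size s'' <= index f s'.
  by case: Es' => ->; rewrite index_cat (negPf fs'') leq_addr.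
by move: es' lt ge'; rewrite -index_mem sz; lia.
Qed.

(** * Construction of a reordering that ends with the racing pair *)

Section Schedule.
Variables e e' : event T X L.
Variable D : pred (event T X L).
Hypothesis s_trace : is_trace s.
Hypotheses (es : e \in s) (es' : e' \in s) (e'e : index e' s < index e s).
Hypothesis conf : conflicting e' e.
Hypothesis DP : forall f, f \in s -> D f <->
  seen s (index e s) (on_thread (thr e)) f \/
  seen s (index e' s) (on_thread (thr e')) f.
Hypothesis De' : ~ seen s (index e s) (on_thread (thr e)) e'.

Let s'' := filter D s.
Let s' := s'' ++ [:: e'; e].

Let us : uniq s. Proof. by case: s_trace => /map_uniq. Qed.

Let ae : is_access e.
Proof. by case: conf => _ [x [_ ax _]]; exact: accesses_is_access ax. Qed.

Let ae' : is_access e'.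
Proof. by case: conf => _ [x [ax _ _]]; exact: accesses_is_access ax. Qed.

Let thr_ne : thr e' <> thr e. Proof. by case: conf. Qed.

Let D_lt f : f \in s -> D f -> index f s < index e s.
Proof.
move=> fs /(DP fs)[/seen_lt//|/seen_lt lt]; exact: ltn_trans e'e.
Qed.

Let D_closed f g : SHB_le s f g -> D g -> D f.
Proof.
move=> fg; have [fs gs _] := SHB_le_tr_le fg.
by move=> /(DP gs) Dg; apply/(DP fs); case: Dg => -[h [hs hn ht gh]]; [left|right];
  exists h; split=> //; exact: oc_trans fg gh.
Qed.

Let D_e : ~~ D e. Proof. by apply/negP => /(D_lt es); rewrite ltnn. Qed.

Let D_e' : ~~ D e'.
Proof. by apply/negP => /(DP es')[//|/seen_lt]; rewrite ltnn. Qed.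

Let D_thread_e f : f \in s -> thr e \in event_threads f ->
  D f = (index f s < index e s).
Proof.
move=> fs ft; apply/idP/idP => [/(D_lt fs)//|lt]; apply/(DP fs); left.
exact: seen_self.
Qed.

(** An event of [thr e'] at or after [e'] is HB-above [e']; if it were in [D], downward closure
    would put [e'] in [D]. *)
Let D_thread_e' f : f \in s -> thr e' \in event_threads f ->
  D f = (index f s < index e' s).
Proof.
move=> fs ft; apply/idP/idP => [Df|lt]; last first.
  by apply/(DP fs); right; exact: seen_self.
rewrite ltnNge; apply/negP => le; move/negP: D_e'; apply.
apply: D_closed Df; apply: HB_le_SHB_le.
by apply: (HB_le_thread es' fs le _ ft); exact: thr_event_threads.
Qed.

(** On its own thread [a] is the next event after those kept by [D], so appending it still gives a
    prefix. *)
Let proj_cut a : a \in s ->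
  (forall f, f \in s -> thr a \in event_threads f -> D f = (index f s < index a s)) ->
  prefix (rcons (proj s'' (thr a)) a) (proj s (thr a)).
Proof.
move=> as_ DA.
have -> : proj s'' (thr a) = proj (take (index a s) s) (thr a).
  rewrite /proj /s'' -{1}(cat_take_drop (index a s) s) !filter_cat.
  rewrite -[RHS]cats0; congr (_ ++ _).
    rewrite -filter_predI; apply: eq_in_filter => f ft /=.
    have fs := mem_take ft; case: (boolP (_ \in _)) => //= tf.
    by rewrite DA // -in_take.
  apply/eqP; rewrite -(negbK (_ == _)) -has_filter; apply/hasPn => f.
  rewrite mem_filter => /andP[Df fd]; apply/negP => tf.
  have fs := mem_drop fd; rewrite DA // -in_take // in Df.
  move: us; rewrite -(cat_take_drop (index a s) s) cat_uniq => /and3P[_ /hasPn/(_ f fd)].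
  by rewrite Df.
have -> : proj s (thr a) = rcons (proj (take (index a s) s) (thr a)) a ++
    proj (drop (index a s).+1 s) (thr a).
  rewrite /proj -{1}(cat_take_drop (index a s) s) filter_cat drop_index //=.
  by rewrite thr_event_threads cat_rcons.
exact: prefix_prefix.
Qed.

Let proj_s' t : proj s' t = proj s'' t ++
  (if t == thr e' then [:: e'] else if t == thr e then [:: e] else [::]).
Proof.
rewrite /proj /s' filter_cat /= !event_threads_access // !inE.
case: (eqVneq t (thr e')) => [->|_]; last by case: eqVneq.
by case: eqVneq => // /thr_ne.
Qed.

(** By [lock_order] the operations of a lock form an HB chain, so the downward closed [D] keeps a
    prefix of them. *)
Let s''_lock : lock_wf s''.
Proof.
move=> l; have [ts pre] := s_trace.2 l; exists ts; apply: prefix_trans pre.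
rewrite /s'' -filter_predI (eq_filter (a2 := predI D (fun e => is_lock_op l (opr e))));
  last by move=> f /=; rewrite andbC.
rewrite filter_predI.
have : prefix [seq f <- [seq f <- s | is_lock_op l (opr f)] | D f]
    [seq f <- s | is_lock_op l (opr f)].
  apply: prefix_filter_filter; apply: pairwise_index => // f g fs gs lt.
  apply/implyP => fl; apply/implyP => gl; apply/implyP; apply: D_closed.
  apply: HB_le_SHB_le; apply: (lock_order us s_trace.2 fs gs fl gl); exact: ltnW.
by case/prefixP => q {2}->; rewrite map_cat prefix_prefix.
Qed.

Let s''_trace : is_trace s''.
Proof.
split=> //; case: s_trace => + _; apply: subseq_uniq.
exact/map_subseq/filter_subseq.
Qed.

Let s'_trace : is_trace s'.
Proof.
split; last first.
  move=> l; have [ts pre] := s''_lock l; exists ts.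
  move: ae ae'; rewrite /s' filter_cat /is_access /=.
  by case: (opr e) => // x _; case: (opr e') => // y _; rewrite cats0.
have [uid _] := s_trace.
have inj : {in s &, injective (@eid T X L)}.
  move=> f g fs gs fg; rewrite -(nth_index e fs) -(nth_index e gs).
  have lt h : h \in s -> index h s < size (map (@eid T X L) s).
    by rewrite size_map index_mem.
  congr nth; apply/eqP; rewrite -(nth_uniq (eid e) (lt _ fs) (lt _ gs) uid).
  by rewrite !(nth_map e) ?index_mem // !nth_index // fg.
rewrite map_inj_in_uniq; last first.
  apply: sub_in2 inj => f; rewrite mem_cat mem_filter !inE.
  by case/or3P=> [/andP[]//|/eqP->|/eqP->].
rewrite cat_uniq filter_uniq //= !mem_filter (negPf D_e) (negPf D_e') /= !inE andbT.
by apply/eqP => E; apply: thr_ne; rewrite E.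
Qed.

Let s''_index f g : f \in s'' -> g \in s'' -> index f s <= index g s ->
  index f s' <= index g s'.
Proof.
move=> fs'' gs''; rewrite /s' !index_cat fs'' gs'' leq_eqVlt => /orP[/eqP E|lt].
  have fs : f \in s by move: fs''; rewrite mem_filter => /andP[].
  have gs : g \in s by move: gs''; rewrite mem_filter => /andP[].
  by rewrite -(nth_index f fs) E nth_index.
have Dg : D g by move: gs''; rewrite mem_filter => /andP[].
apply: ltnW; rewrite -in_take // take_index_filter //.
by move: fs''; rewrite !mem_filter => /andP[-> fs]; rewrite in_take.
Qed.

Let s'_reorders : correct_reordering s s'.
Proof.
split=> [//|t _|f x fs' fx].
  rewrite proj_s'; case: eqVneq => [->|_].
    by rewrite cats1; exact: proj_cut D_thread_e'.
  case: eqVneq => [->|_]; first by rewrite cats1; exact: proj_cut D_thread_e.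
  rewrite cats0 /proj /s'' -filter_predI.
  rewrite (eq_filter (a2 := predI D (fun e => t \in event_threads e)));
    last by move=> g /=; rewrite andbC.
  rewrite filter_predI; apply: prefix_filter_filter.
  apply: pairwise_index => // g h gs hs lt.
  apply/implyP => gt; apply/implyP => ht; apply/implyP; apply: D_closed.
  apply: HB_le_SHB_le; exact: (HB_le_thread gs hs (ltnW lt) gt ht).
(* [e'] and [e] are the last events of their threads in [s'], so the condition on reads exempts
   them. *)
rewrite proj_s'; have [fe'|/eqP fe'] := eqVneq f e'.
  by rewrite fe' eqxx last_cat eqxx.
have [fe|/eqP fe _] := eqVneq f e.
  by rewrite fe eqxx; case: (eqVneq (thr e)) => [/esym/thr_ne|_] //;
    rewrite last_cat eqxx.
have fs'' : f \in s''.
  move: fs'; rewrite mem_cat !inE => /or3P[//|/eqP/fe'|/eqP/fe] //.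
have [Df fs] : D f /\ f \in s by move: fs''; rewrite mem_filter => /andP[].
rewrite /lastWr fx /s' index_cat fs'' takel_cat; last by rewrite ltnW ?index_mem.
rewrite take_index_filter //.
rewrite -filter_predI (eq_filter (a2 := predI D (fun f => opr f == Write x)));
  last by move=> g /=; rewrite andbC.
(* The last write before a kept read is SHB-below it, hence kept, and dropping other writes before
   the read does not change which one is last. *)
rewrite filter_predI; apply: last_filter_some => g lw; apply: D_closed Df.
by apply: oc_step; right; rewrite (lastWr_read _ fx).
Qed.

Let s'_HB : respects_HB s s'.
Proof.
(* A strict HB-predecessor of an access passes through an earlier event of its thread, which [D]
   contains. *)
have into a f : a \in s -> is_access a -> f \in s ->
    (forall f, f \in s -> thr a \in event_threads f ->
     D f = (index f s < index a s)) ->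
    f <> a -> HB_le s f a -> f \in s''.
  move=> as_ aa fs DA fa /HB_le_access[]// g [gs ga tg fg].
  rewrite mem_filter fs andbT; apply: D_closed (HB_le_SHB_le fg) _.
  by rewrite DA.
have ss' f : f \in s'' -> f \in s' by rewrite mem_cat => ->.
have es1 : e \in s' by rewrite mem_cat !inE eqxx !orbT.
have es2 : e' \in s' by rewrite mem_cat !inE eqxx !orbT.
have before f a : f \in s'' -> a \notin s'' -> index f s' <= index a s'.
  move=> fs'' /negPf as_; rewrite /s' !index_cat fs'' as_.
  by apply: leq_trans (leq_addr _ _); rewrite ltnW ?index_mem.
have eN : e \notin s'' by rewrite mem_filter negb_and D_e.
have e'N : e' \notin s'' by rewrite mem_filter negb_and D_e'.
move=> f g fs gs fg; rewrite mem_cat !inE => /or3P[gs''|/eqP E|/eqP E].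
- have Dg : D g by move: gs''; rewrite mem_filter => /andP[].
  have fs'' : f \in s''.
    by rewrite mem_filter fs andbT; exact: D_closed (HB_le_SHB_le fg) Dg.
  have [_ _ le] := HB_le_tr_le fg.
  by split; [|split=> //]; auto.
- have [->|/eqP fe] := eqVneq f e'; first by rewrite E; split.
  rewrite E in fg *.
  have fs'' : f \in s'' by exact: (into e').
  by split; [|split]; auto.
have [->|/eqP fe] := eqVneq f e; first by rewrite E; split.
rewrite E in fg *.
have fs'' : f \in s'' by exact: (into e).
by split; [|split]; auto.
Qed.

Lemma not_seen_schedulable : HB_schedulable_race s e' e.
Proof.
split=> //; first by split=> //; exact: ltnW.
exists s'; split=> //; exists s''; split=> //; by left.
Qed.
End Schedule.
End Schedulable.

Theorem theorem4p2 (T X L : eqType) (s : seq (event T X L)) (e : event T X L)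
  (s_trace : is_trace s) (s_fork_join : fork_join_wf s)
  (e_in_s : e \in s) (e_access : is_access e) :
  reports_race s e <->
  exists e' : event T X L, e' \in s /\ HB_schedulable_race s e' e.
Proof.
have [/map_uniq us lw] := s_trace.
have pP a f : a \in s -> f \in s -> precedes s a f <->
    seen s (index a s) (on_thread (thr a)) f by exact: precedesP.
rewrite reports_raceE //; split=> [[f [fs fe conf nf]]|[f [fs race]]].
  exists f; split=> //.
  (* The kept set is computed from the clocks: thread predecessors of [e] or of [f], closed
     downwards under SHB. *)
  apply: (not_seen_schedulable (D := predU (precedes s e) (precedes s f))) => //.
    move=> g gs; rewrite -!pP //=.
    by split=> [/orP|H]; last apply/orP.
  by rewrite -pP //; exact/negP.
have [conf [_ _ le] _] := race.
exists f; split=> //; last first.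
  apply/negP; rewrite pP //; exact: schedulable_not_seen race.
apply: index_lt_neq => // E; case: conf => + _; by rewrite E.
Qed.
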